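(* Let $K$ be a field, let $(Q,I)$ be a gentle quiver, and let $A=KQ/I$ be the corresponding (finite-dimensional) gentle algebra. For $k\ge 1$ denote by $c_k$ the number of minimal oriented $k$-cycles in $Q$ with full zero relations. Then the $q$-Cartan matrix $C_A(q)$ has determinant $$\det C_A(q)=\prod_{k\geq 1}\bigl(1-(-q)^k\bigr)^{c_k}.$$
   Context: A quiver $Q$ is a finite directed graph (loops and multiple arrows allowed) with vertex set $Q_0$; for an arrow $\alpha$, $s(\alpha)$ is its start vertex and $t(\alpha)$ its end vertex. Paths are read from left to right: an oriented path of length $r\ge 1$ is a sequence $\alpha_1\alpha_2\cdots\alpha_r$ of arrows with $t(\alpha_i)=s(\alpha_{i+1})$, and each vertex $v$ has a trivial path $e_v$ of length $0$. The path algebra $KQ$ has all oriented paths as $K$-basis, and multiplication is concatenation (zero if the paths cannot be concatenated). An ideal $I\subset KQ$ is admissible if $I\subseteq J^2$, where $J$ is the ideal generated by the arrows. A pair $(Q,I)$ with $I$ an admissible ideal of $KQ$ is a gentle quiver if: (i) each vertex is the start point of at most two arrows and the end point of at most two arrows; (ii) for each arrow $\alpha$ there is at most one arrow $\beta$ with $\alpha\beta\notin I$ and at most one arrow $\gamma$ with $\gamma\alpha\notin I$; (iii) $I$ is generated by paths of length $2$; (iv) for each arrow $\alpha$ there is at most one arrow $\beta'$ with $t(\alpha)=s(\beta')$ and $\alpha\beta'\in I$, and at most one arrow $\gamma'$ with $t(\gamma')=s(\alpha)$ and $\gamma'\alpha\in I$. A finite-dimensional algebra of the form $KQ/I$ with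 $(Q,I)$ gentle is called a gentle algebra; finite-dimensionality of $KQ/I$ is always assumed. The $q$-Cartan matrix of a finite-dimensional algebra $A=KQ/I$ with $I$ generated by homogeneous relations (linear combinations of paths of the same length) is the $|Q_0|\times|Q_0|$ matrix $C_A(q)=(c_{ij}(q))$ over $\mathbb{Z}[q]$, $q$ an indeterminate, with $c_{ij}(q)=\sum_n \dim_K (e_iAe_j)_n\,q^n$, where $e_iAe_j=\bigoplus_n (e_iAe_j)_n$ is the grading induced by path length. An oriented $k$-cycle with full zero relations ($k\ge1$) is an oriented path $p=p_0p_1\cdots p_{k-1}$ with arrows $p_0,\dots,p_{k-1}$ in $Q$ having the same start and end point and such that $p_ip_{i+1}\in I$ for $i=0,\dots,k-2$ and $p_{k-1}p_0\in I$. It is minimal if $p_0,\dots,p_{k-1}$ are pairwise different arrows. Such cycles are counted up to cyclic rotation (choice of starting point). *)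

(* Defs.v *)
From HB Require Import structures.
From mathcomp Require Import all_boot all_algebra finmap.
From mathcomp.multinomials Require Import monalg.
From mathcomp Require Import boolp classical_sets fsbigop.

Set Implicit Arguments.
Unset Strict Implicit.
Unset Printing Implicit Defensive.

Import GRing.Theory.
Local Open Scope ring_scope.
Local Open Scope quotient_scope.

(** * Quivers and their paths *)

Record quiver := Quiver {
  vertex : finType;
  arrow : finType;
  src : arrow -> vertex;
  tgt : arrow -> vertex
}.

Arguments src {q} _.
Arguments tgt {q} _.

Section Paths.
Variable Q : quiver.

Fixpoint is_qpath (v : vertex Q) (s : seq (arrow Q)) : bool :=
  if s is a :: s' then (src a == v) && is_qpath (tgt a) s' else true.

(* The start vertex is recorded so that each vertex [v] has its own trivial
   path [(v, [::])]. *)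
Record qpath := QPath {
  qpath_val : vertex Q * seq (arrow Q);
  _ : is_qpath qpath_val.1 qpath_val.2
}.

HB.instance Definition _ := [isSub for qpath_val].
HB.instance Definition _ := [Choice of qpath by <:].

Definition pstart (p : qpath) : vertex Q := (qpath_val p).1.
Definition parrows (p : qpath) : seq (arrow Q) := (qpath_val p).2.
Definition pend (p : qpath) : vertex Q := last (pstart p) (map tgt (parrows p)).
Definition plength (p : qpath) : nat := size (parrows p).

Definition trivial_path (v : vertex Q) : qpath := @QPath (v, [::]) isT.

Lemma arrow_path_subproof (a : arrow Q) : is_qpath (src a) [:: a].
Proof. by rewrite /= eqxx. Qed.

Definition arrow_path (a : arrow Q) : qpath :=
  @QPath (src a, [:: a]) (arrow_path_subproof a).

(* The guard is needed for trivial paths; once it holds, [insub] succeeds by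
   [pconcatE] below. *)
Definition pconcat (p q : qpath) : option qpath :=
  if pend p == pstart q then insub (pstart p, parrows p ++ parrows q)
  else None.

Lemma is_qpath_cat v s1 s2 :
  is_qpath v (s1 ++ s2) = is_qpath v s1 && is_qpath (last v (map tgt s1)) s2.
Proof. by elim: s1 v => //= a s1 IHs v; rewrite IHs andbA. Qed.

Lemma qpathP (p : qpath) : is_qpath (pstart p) (parrows p).
Proof. exact: (valP p). Qed.

Lemma qpath_inj (p q : qpath) :
  pstart p = pstart q -> parrows p = parrows q -> p = q.
Proof.
case: p q => [[v s] vs] [[w t] wt]; rewrite /pstart /parrows /= => vw st.
by apply/val_inj; rewrite /= vw st.
Qed.

Lemma pconcatE (p q : qpath) : pend p = pstart q ->
  exists2 r, pconcat p q = Some r &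
    [/\ pstart r = pstart p, parrows r = parrows p ++ parrows q
      & pend r = pend q].
Proof.
move=> pq; rewrite /pconcat pq eqxx.
have pqP : is_qpath (pstart p) (parrows p ++ parrows q).
  by rewrite is_qpath_cat qpathP -/(pend p) pq qpathP.
rewrite (@insubT _ (fun x => is_qpath x.1 x.2) _
  (pstart p, parrows p ++ parrows q) pqP).
eexists; first by [].
by split; rewrite // /pend /parrows /pstart /= map_cat last_cat -/(pend p) pq.
Qed.

Lemma pconcatN (p q : qpath) : pend p != pstart q -> pconcat p q = None.
Proof. by rewrite /pconcat => /negPf ->. Qed.

Lemma pconcat_trivl v (p : qpath) :
  pconcat (trivial_path v) p = if v == pstart p then Some p else None.
Proof.
have [vp|] := eqVneq v; last by move=> vp; rewrite pconcatN.
have [r -> [rs ra _]] := @pconcatE (trivial_path v) p vp.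
by congr Some; apply: qpath_inj; rewrite // rs -vp.
Qed.

Lemma pconcat_trivr v (p : qpath) :
  pconcat p (trivial_path v) = if pend p == v then Some p else None.
Proof.
have [vp|] := eqVneq (pend p); last by move=> vp; rewrite pconcatN.
have [r -> [rs ra _]] := @pconcatE p (trivial_path v) vp.
by congr Some; apply: qpath_inj; rewrite // ra cats0.
Qed.

Lemma pconcatA (p q r : qpath) :
  obind (pconcat p) (pconcat q r) = obind (pconcat^~ r) (pconcat p q).
Proof.
have [pq|pq] := eqVneq (pend p) (pstart q); last first.
  rewrite (pconcatN pq) /=.
  have [qr|qr] := eqVneq (pend q) (pstart r); last by rewrite (pconcatN qr).
  have [s -> [ss _ _]] := pconcatE qr.
  by rewrite /= pconcatN // ss.
have [s -> [ss sa se]] := pconcatE pq; rewrite /=.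
have [qr|qr] := eqVneq (pend q) (pstart r); last first.
  by rewrite (pconcatN qr) /= pconcatN // se.
have [t -> [ts ta te]] := pconcatE qr; rewrite /=.
have [u -> [us ua ue]] := @pconcatE p t (etrans pq (esym ts)).
have [w -> [ws wa we]] := @pconcatE s r (etrans se qr).
congr Some; apply: qpath_inj; first by rewrite us ws.
by rewrite ua wa ta sa catA.
Qed.

End Paths.

(** * The path algebra *)

Section PathAlgebraDef.
Variables (K : fieldType) (Q : quiver).

Definition pathalg := {malg K[qpath Q]}.

HB.instance Definition _ := GRing.Lmodule.on pathalg.

Definition pterm (c : K) (p q : qpath Q) : pathalg :=
  if pconcat p q is Some r then << c *g r >> else 0.

End PathAlgebraDef.

(* Bilinear extension of concatenation of paths. *)
HB.lock Definition pamul (K : fieldType) (Q : quiver) (x y : pathalg K Q) :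
    pathalg K Q :=
  \sum_(p <- msupp x) \sum_(q <- msupp y) pterm (x@_p * y@_q) p q.

Section PathAlgebra.
Variables (K : fieldType) (Q : quiver).
Local Notation pathalg := (pathalg K Q).
Local Notation pamul := (@pamul K Q).
Local Notation pterm := (@pterm K Q).

(* The trivial path [e_v] as an element of the path algebra. *)
Definition pidem (v : vertex Q) : pathalg := << trivial_path v >>.

Definition paone : pathalg := \sum_v pidem v.

Lemma ptermDl p q : {morph (fun c : K => pterm c p q) : c d / c + d}.
Proof.
by move=> c d; rewrite /pterm; case: pconcat => [r|]; rewrite ?monalgUD ?addr0.
Qed.

Lemma pterm0 p q : pterm 0 p q = 0.
Proof. by rewrite /pterm; case: pconcat => [r|//]; rewrite monalgU0. Qed.

Lemma pamulEw (d1 d2 : {fset (qpath Q)}) (x y : pathalg) :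
  (msupp x `<=` d1)%fset -> (msupp y `<=` d2)%fset ->
  pamul x y = \sum_(p <- d1) \sum_(q <- d2) pterm (x@_p * y@_q) p q.
Proof.
move=> le1 le2; rewrite unlock.
rewrite (big_fset_incl _ le1) /= => [|p _ px]; last first.
  by rewrite big1_fset // => q _ _; rewrite (mcoeff_outdom px) mul0r pterm0.
apply: eq_bigr => p _; apply: (big_fset_incl _ le2) => q _ qy.
by rewrite (mcoeff_outdom qy) mulr0 pterm0.
Qed.

Lemma pamulDl : left_distributive pamul +%R.
Proof.
move=> x y z; pose d := (msupp x `|` msupp y `|` msupp (x + y))%fset.
have lex : (msupp x `<=` d)%fset by rewrite /d -fsetUA fsubsetUl.
have ley : (msupp y `<=` d)%fset by rewrite /d fsetUAC fsubsetUr.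
have lexy : (msupp (x + y) `<=` d)%fset by rewrite /d fsubsetUr.
have zz := fsubset_refl (msupp z).
rewrite (pamulEw lexy zz) (pamulEw lex zz) (pamulEw ley zz).
rewrite -big_split; apply: eq_bigr => p _; rewrite -big_split.
by apply: eq_bigr => q _; rewrite mcoeffD mulrDl ptermDl.
Qed.

Lemma pamulDr : right_distributive pamul +%R.
Proof.
move=> z x y; pose d := (msupp x `|` msupp y `|` msupp (x + y))%fset.
have lex : (msupp x `<=` d)%fset by rewrite /d -fsetUA fsubsetUl.
have ley : (msupp y `<=` d)%fset by rewrite /d fsetUAC fsubsetUr.
have lexy : (msupp (x + y) `<=` d)%fset by rewrite /d fsubsetUr.
have zz := fsubset_refl (msupp z).
rewrite (pamulEw zz lexy) (pamulEw zz lex) (pamulEw zz ley).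
rewrite -big_split; apply: eq_bigr => p _; rewrite -big_split.
by apply: eq_bigr => q _; rewrite mcoeffD mulrDr ptermDl.
Qed.

Lemma pamul0l : left_zero 0 pamul.
Proof. by move=> x; apply: (addrI (pamul 0 x)); rewrite -pamulDl !addr0. Qed.

Lemma pamul0r : right_zero 0 pamul.
Proof. by move=> x; apply: (addrI (pamul x 0)); rewrite -pamulDr !addr0. Qed.

Lemma pamulUU c d (p q : qpath Q) :
  pamul << c *g p >> << d *g q >> = pterm (c * d) p q.
Proof.
rewrite (pamulEw (@msuppU_le _ _ _ _) (@msuppU_le _ _ _ _)).
by rewrite !big_seq_fset1 !mcoeffUU.
Qed.

Lemma pamul_suml (I : Type) (r : seq I) (P : pred I) (F : I -> pathalg) y :
  pamul (\sum_(i <- r | P i) F i) y = \sum_(i <- r | P i) pamul (F i) y.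
Proof.
apply: (big_morph (pamul^~ y)) => [u v|]; first exact: pamulDl.
exact: pamul0l.
Qed.

Lemma pamul_sumr (I : Type) (r : seq I) (P : pred I) (F : I -> pathalg) x :
  pamul x (\sum_(i <- r | P i) F i) = \sum_(i <- r | P i) pamul x (F i).
Proof.
apply: (big_morph (pamul x)) => [u v|]; first exact: pamulDr.
exact: pamul0r.
Qed.

Lemma pathalg_ind (P : pathalg -> Prop) :
  P 0 -> (forall x y, P x -> P y -> P (x + y)) ->
  (forall c p, P << c *g p >>) -> forall x, P x.
Proof. by move=> P0 PD PU x; rewrite [x]monalgE; apply: big_ind. Qed.

(* Basis elements are abstracted before rewriting, since failed unification
   between two terms [<< c *g p >>] unfolds them and is very slow. *)
Lemma pamulA : associative pamul.
Proof.
move=> x y z; elim/pathalg_ind: x => [|x x' IH IH'|c p].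
- by rewrite (pamul0l (pamul y z)) (pamul0l y) (pamul0l z).
- by rewrite (pamulDl x x') (pamulDl x x') (pamulDl (pamul x y)) IH IH'.
have [u uE] := ex_intro (eq^~ (<< c *g p >> : pathalg)) _ erefl.
rewrite -uE; elim/pathalg_ind: y => [|y y' IH IH'|d q].
- by rewrite (pamul0l z) (pamul0r u) (pamul0l z).
- by rewrite (pamulDl y y') (pamulDr u (pamul y z)) (pamulDr u y)
    (pamulDl (pamul u y)) IH IH'.
have [v vE] := ex_intro (eq^~ (<< d *g q >> : pathalg)) _ erefl.
rewrite -vE; elim/pathalg_ind: z => [|z z' IH IH'|e r].
- by rewrite (pamul0r v) (pamul0r u) (pamul0r (pamul u v)).
- by rewrite (pamulDr v z) (pamulDr u (pamul v z)) (pamulDr (pamul u v) z)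
    IH IH'.
have [w wE] := ex_intro (eq^~ (<< e *g r >> : pathalg)) _ erefl.
rewrite -wE.
have -> : pamul u v = if pconcat p q is Some t then << c * d *g t >> else 0.
  by rewrite uE vE pamulUU.
have -> : pamul v w = if pconcat q r is Some s then << d * e *g s >> else 0.
  by rewrite vE wE pamulUU.
have uM s a : pamul u << a *g s >> = pterm (c * a) p s by rewrite uE pamulUU.
have wM s a : pamul << a *g s >> w = pterm (a * e) s r by rewrite wE pamulUU.
have := pconcatA p q r.
case: (pconcat q r) => [s|]; case: (pconcat p q) => [t|] /=.
- by rewrite uM wM /pterm mulrA => ->.
- by rewrite uM (pamul0l w) /pterm => ->.
- by rewrite wM (pamul0r u) /pterm => <-.
- by rewrite (pamul0l w) (pamul0r u).
Qed.

Lemma pamul1l : left_id paone pamul.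
Proof.
elim/pathalg_ind => [|x y IHx IHy|c p].
- exact: pamul0r.
- by rewrite pamulDr IHx IHy.
rewrite pamul_suml (bigD1 (pstart p)) //= big1 => [|v vp].
  by rewrite pamulUU /pterm pconcat_trivl eqxx mul1r addr0.
by rewrite pamulUU /pterm pconcat_trivl (negPf vp).
Qed.

Lemma pamul1r : right_id paone pamul.
Proof.
elim/pathalg_ind => [|x y IHx IHy|c p].
- exact: pamul0l.
- by rewrite pamulDl IHx IHy.
rewrite pamul_sumr (bigD1 (pend p)) //= big1 => [|v vp].
  by rewrite pamulUU /pterm pconcat_trivr eqxx mulr1 addr0.
by rewrite pamulUU /pterm pconcat_trivr eq_sym (negPf vp).
Qed.

(* [pzRingType] since the path algebra of the empty quiver is zero. *)
HB.instance Definition _ := GRing.Zmodule_isPzRing.Build pathalg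
  pamulA pamul1l pamul1r pamulDl pamulDr.

Lemma pathalgM (x y : pathalg) : x * y = pamul x y.
Proof. by []. Qed.

Lemma pathalgUZ c d (p : qpath Q) :
  c *: << d *g p >> = << (c * d) *g p >> :> pathalg.
Proof.
apply/malgP => q.
have [u uE] := ex_intro (eq^~ (<< d *g p >> : pathalg)) _ erefl.
have [v vE] := ex_intro (eq^~ (<< (c * d) *g p >> : pathalg)) _ erefl.
by rewrite -uE -vE mcoeffZ uE mcoeffU vE mcoeffU mulrnAr.
Qed.

Lemma ptermZ c d p q : c *: pterm d p q = pterm (c * d) p q.
Proof.
by rewrite /pterm; case: pconcat => [r|]; [exact: pathalgUZ|exact: scaler0].
Qed.

Lemma pathalg_scaleAl c (x y : pathalg) : c *: (x * y) = (c *: x) * y.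
Proof.
rewrite !pathalgM; elim/pathalg_ind: x => [|x x' IH IH'|d p].
- by rewrite scaler0 (pamul0l y) scaler0.
- by rewrite scalerDr (pamulDl x) scalerDr IH IH' -pamulDl.
rewrite pathalgUZ.
have [u uE] := ex_intro (eq^~ (<< d *g p >> : pathalg)) _ erefl.
have [v vE] := ex_intro (eq^~ (<< (c * d) *g p >> : pathalg)) _ erefl.
rewrite -uE -vE; elim/pathalg_ind: y => [|y y' IH IH'|e q].
- by rewrite (pamul0r u) (pamul0r v) scaler0.
- by rewrite (pamulDr u y) (pamulDr v y) scalerDr IH IH'.
have [w wE] := ex_intro (eq^~ (<< e *g q >> : pathalg)) _ erefl.
rewrite -wE.
have -> : pamul u w = pterm (d * e) p q by rewrite uE wE pamulUU.
have -> : pamul v w = pterm (c * d * e) p q by rewrite vE wE pamulUU.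
by rewrite ptermZ mulrA.
Qed.

Lemma pathalg_scale1 c (x : pathalg) : c *: x = (c *: (1 : pathalg)) * x.
Proof. by rewrite -pathalg_scaleAl mul1r. Qed.

Definition pathelt (p : qpath Q) : pathalg := << p >>.

Lemma patheltM p q :
  pathelt p * pathelt q = if pconcat p q is Some r then pathelt r else 0.
Proof. by rewrite pathalgM /pathelt pamulUU mulr1. Qed.

Definition arrowelt (a : arrow Q) : pathalg := pathelt (arrow_path a).

End PathAlgebra.

(** * Two-sided ideals and quotient rings *)

Definition mul_closed_ideal (R : pzRingType) (S : {pred R}) : Prop :=
  forall a u, u \in S -> (a * u \in S) /\ (u * a \in S).

HB.mixin Record isMulClosedIdeal (R : pzRingType) (S : R -> bool) := {
  mul_closed_ideal_subproof : mul_closed_ideal S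
}.

(* [idealr] of ring_quotient is left-sided, proper and needs a nontrivial
   ring. *)
#[short(type="ideal2")]
HB.structure Definition Ideal2 (R : pzRingType) :=
  {S of GRing.ZmodClosed R S & isMulClosedIdeal R S}.

Section Ideal2Theory.
Variables (R : pzRingType) (I : ideal2 R).

Lemma ideal2Ml a u : u \in I -> a * u \in I.
Proof. by move=> uI; have [] := @mul_closed_ideal_subproof R I a u uI. Qed.

Lemma ideal2Mr a u : u \in I -> u * a \in I.
Proof. by move=> uI; have [] := @mul_closed_ideal_subproof R I a u uI. Qed.

End Ideal2Theory.

(* Ideals are boolean predicates; by classical logic this covers every subset
   of [R]. *)
Definition generated_ideal (R : pzRingType) (S : set R) : set R :=
  [set x | forall J : ideal2 R, (forall y, S y -> y \in J) -> x \in J].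

Definition ideal_prod (R : pzRingType) (S T : set R) : set R :=
  generated_ideal [set z | exists x y, [/\ S x, T y & z = x * y]].

Section QuotientRing.
Variables (R : pzRingType) (I : ideal2 R).

Definition quotring := {ideal_quot I}.

HB.instance Definition _ := GRing.Zmodule.on quotring.

Definition quotpi : R -> quotring := \pi_{ideal_quot I}.

Definition quotone : quotring := quotpi 1.
Definition quotmul (x y : quotring) : quotring := quotpi (repr x * repr y).

Lemma quotpiP x y : reflect (quotpi x = quotpi y) (x - y \in I).
Proof. by rewrite Quotient.idealrBE; apply: eqP. Qed.

Lemma quotpi_repr (x : quotring) : quotpi (repr x) = x.
Proof. exact: reprK. Qed.

Lemma quotpiD : {morph quotpi : x y / x + y}.
Proof. by move=> x y; rewrite /quotpi !piE. Qed.

Lemma quotpiM x y : quotpi (x * y) = quotmul (quotpi x) (quotpi y).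
Proof.
apply/quotpiP; set x' := repr _; set y' := repr _.
have xx' : x - x' \in I by apply/quotpiP; rewrite quotpi_repr.
have yy' : y - y' \in I by apply/quotpiP; rewrite quotpi_repr.
rewrite -[x * y](subrK (x' * y)) -mulrBl -addrA -mulrBr.
by apply: rpredD; [rewrite ideal2Mr|rewrite ideal2Ml].
Qed.

Lemma quotmulA : associative quotmul.
Proof.
move=> x y z; rewrite -[x]quotpi_repr -[y]quotpi_repr -[z]quotpi_repr.
by rewrite -!quotpiM mulrA.
Qed.

Lemma quotmul1l : left_id quotone quotmul.
Proof. by move=> x; rewrite -[x]quotpi_repr -quotpiM mul1r. Qed.

Lemma quotmul1r : right_id quotone quotmul.
Proof. by move=> x; rewrite -[x]quotpi_repr -quotpiM mulr1. Qed.

Lemma quotmulDl : left_distributive quotmul +%R.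
Proof.
move=> x y z; rewrite -[x]quotpi_repr -[y]quotpi_repr -[z]quotpi_repr.
by rewrite -quotpiD -!quotpiM -quotpiD mulrDl.
Qed.

Lemma quotmulDr : right_distributive quotmul +%R.
Proof.
move=> x y z; rewrite -[x]quotpi_repr -[y]quotpi_repr -[z]quotpi_repr.
by rewrite -quotpiD -!quotpiM -quotpiD mulrDr.
Qed.

HB.instance Definition _ := GRing.Zmodule_isPzRing.Build quotring
  quotmulA quotmul1l quotmul1r quotmulDl quotmulDr.

End QuotientRing.

(** * Dimensions *)

Section Dimension.
Variables (K : fieldType) (V : lmodType K).

Definition is_basis (W : set V) (n : nat) (b : 'I_n -> V) : Prop :=
  [/\ forall i, W (b i),
      forall c : 'I_n -> K, \sum_i c i *: b i = 0 -> forall i, c i = 0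
    & forall w, W w -> exists c : 'I_n -> K, w = \sum_i c i *: b i].

Definition finite_dim (W : set V) : Prop := exists n b, @is_basis W n b.

(* 0 by convention if [W] is infinite-dimensional. *)
Definition dimK (W : set V) : nat :=
  xget 0%N [set n | exists b, @is_basis W n b].

End Dimension.

(** * Quotients of path algebras *)

Section QuiverAlgebra.
Variables (K : fieldType) (Q : quiver) (I : ideal2 (pathalg K Q)).

Definition quiver_alg := quotring I.

HB.instance Definition _ := GRing.PzRing.on quiver_alg.

Definition qapi : pathalg K Q -> quiver_alg := @quotpi _ I.

Definition qascale (c : K) (x : quiver_alg) : quiver_alg :=
  qapi (c *: repr x).

Lemma qapi_surj (x : quiver_alg) : exists u, x = qapi u.
Proof. by exists (repr x); rewrite [qapi _]quotpi_repr. Qed.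

Lemma qapiD : {morph qapi : x y / x + y}.
Proof. exact: quotpiD. Qed.

Lemma qapiZ c x : qapi (c *: x) = qascale c (qapi x).
Proof.
apply/quotpiP; rewrite -scalerBr pathalg_scale1 ideal2Ml //.
by apply/quotpiP; rewrite quotpi_repr.
Qed.

Lemma qascaleA a b v : qascale a (qascale b v) = qascale (a * b) v.
Proof. by have [u ->] := qapi_surj v; rewrite -!qapiZ scalerA. Qed.

Lemma qascale1 : left_id 1 qascale.
Proof. by move=> v; have [u ->] := qapi_surj v; rewrite -qapiZ scale1r. Qed.

Lemma qascaleDr : right_distributive qascale +%R.
Proof.
move=> a v w; have [x ->] := qapi_surj v; have [y ->] := qapi_surj w.
by rewrite -qapiD -!qapiZ -qapiD scalerDr.
Qed.

Lemma qascaleDl v : {morph qascale^~ v : a b / a + b}.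
Proof.
by move=> a b; have [u ->] := qapi_surj v; rewrite -!qapiZ -qapiD scalerDl.
Qed.

HB.instance Definition _ := GRing.Zmodule_isLmodule.Build K quiver_alg
  qascaleA qascale1 qascaleDr qascaleDl.

(* The span of the paths of length [n]. *)
Definition pathalg_deg (n : nat) : set (pathalg K Q) :=
  [set x | forall p, p \in msupp x -> plength p = n].

Definition qalg_deg (n : nat) : set quiver_alg := qapi @` pathalg_deg n.

Definition qidem (v : vertex Q) : quiver_alg := qapi (pidem K v).

Definition peirce_deg (i j : vertex Q) (n : nat) : set quiver_alg :=
  [set qidem i * a * qidem j | a in qalg_deg n].

(* A finitely supported sum over all [n : nat], which is the intended one when
   [quiver_alg] is finite-dimensional and graded by path length. *)
Definition cartan_entry (i j : vertex Q) : {poly int} :=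
  \sum_(n \in [set: nat]) (dimK (peirce_deg i j n))%:Z *: 'X^n.

Definition cartan_matrix : 'M[{poly int}]_#|vertex Q| :=
  \matrix_(i, j) cartan_entry (enum_val i) (enum_val j).

(** * Gentle quivers and cycles with full zero relations *)

Definition zero_rel (a b : arrow Q) : bool :=
  arrowelt K a * arrowelt K b \in I.

Definition arrow_ideal : set (pathalg K Q) :=
  generated_ideal (range (@arrowelt K Q)).

Definition admissible : Prop :=
  forall x, x \in I -> ideal_prod arrow_ideal arrow_ideal x.

(* If [a] and [b] do not compose then [arrowelt K a * arrowelt K b = 0], so
   [zero_rel a b] holds; composability has to be required separately. *)
Record gentle : Prop := Gentle {
  gentle_admissible : admissible;
  gentle_src : forall v : vertex Q,
    (#|[set a : arrow Q | src a == v]%SET| <= 2)%N;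
  gentle_tgt : forall v : vertex Q,
    (#|[set a : arrow Q | tgt a == v]%SET| <= 2)%N;
  gentle_nonrel_right : forall a b b' : arrow Q,
    ~~ zero_rel a b -> ~~ zero_rel a b' -> b = b';
  gentle_nonrel_left : forall a c c' : arrow Q,
    ~~ zero_rel c a -> ~~ zero_rel c' a -> c = c';
  gentle_generated : exists S : set (qpath Q),
    (forall p, S p -> plength p = 2%N) /\
    (forall x, x \in I <-> generated_ideal (@pathelt K Q @` S) x);
  gentle_rel_right : forall a b b' : arrow Q,
    tgt a = src b -> zero_rel a b -> tgt a = src b' -> zero_rel a b' -> b = b';
  gentle_rel_left : forall a c c' : arrow Q,
    tgt c = src a -> zero_rel c a -> tgt c' = src a -> zero_rel c' a -> c = c'
}.

(* [cycle] also tests the last arrow against the first one; in particular, for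
   [k = 1] the condition is that [p_0] is a loop with [p_0 p_0] in [I]. *)
Definition full_zero_cycle (k : nat) (p : k.-tuple (arrow Q)) : bool :=
  cycle (fun a b : arrow Q => (tgt a == src b) && zero_rel a b) p.

Definition minimal_cycle (k : nat) (p : k.-tuple (arrow Q)) : bool :=
  full_zero_cycle p && uniq p.

Definition rotations (k : nat) (p : k.-tuple (arrow Q)) :
    {set k.-tuple (arrow Q)} :=
  [set rot_tuple i p | i : 'I_k]%SET.

(* The number of rotation classes of minimal [k]-cycles. *)
Definition num_minimal_cycles (k : nat) : nat :=
  #|[set rotations p | p : k.-tuple (arrow Q) & minimal_cycle p]%SET|.

End QuiverAlgebra.

(* Main.v *)
Require Import Defs.
From HB Require Import structures.
From mathcomp Require Import all_boot all_algebra finmap.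
From mathcomp.multinomials Require Import monalg.
From mathcomp Require Import boolp classical_sets fsbigop.

Import GRing.Theory.
Local Open Scope ring_scope.

(** Call a composition [a b] of arrows nonzero if [a b] is not in [I], and let
    [B] and [Z] be the 0/1 matrices, indexed by arrows, of the nonzero
    compositions and of the composable zero relations. Let [S] be the
    vertex-by-arrow matrix of sources and [E] the arrow-by-vertex matrix of
    targets, so that [E S = B + Z].

    Since [I] is generated by paths of length 2, it is spanned by the paths
    that contain a zero relation ([mem_idealP]). Hence the remaining paths form
    a basis of [A], and the entries of the Cartan matrix count them by length
    ([dimK_peirce]): [C = 1 + q S (1 - q B)^-1 E]. Finite-dimensionality bounds
    their lengths, so [B] is nilpotent and [det (1 - q B) = 1]. The identity
    [det (1 + U V) = det (1 + V U)] then gives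
    [det C = det (1 + q (1 - q B)^-1 (B + Z)) = det (1 + q Z)]
    ([det_nonzero_paths]).

    By gentleness each arrow starts at most one composable
    zero relation, i.e. [Z] is the graph of a partial function. For such a
    matrix [1 + q Z] is the product of a factor [1 + q N], with [N] nilpotent,
    and of one factor [1 + q Z_X] for each cycle [X] of the partial function;
    the determinant of the latter is [1 - (-q)^k], with [k] the length of the
    cycle ([det_functional]). The cycles are exactly the minimal oriented
    cycles with full zero relations, up to rotation ([card_cycle_sets]). *)

Set Implicit Arguments.
Unset Strict Implicit.
Unset Printing Implicit Defensive.

(** * Determinants *)

(** Both sides are the determinant of the block matrix with rows [1, -U] and
    [V, 1], eliminated in the two possible ways. *)
Lemma det_1D_mulmxC (R : comNzRingType) m n (U : 'M[R]_(m, n)) (V : 'M_(n, m)) :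
  \det (1%:M + U *m V) = \det (1%:M + V *m U).
Proof.
have EUV : block_mx 1%:M (- U) V 1%:M =
    block_mx 1%:M (- U) 0 1%:M *m block_mx (1%:M + U *m V) 0 V 1%:M.
  by rewrite mulmx_block !(mul1mx, mul0mx, mulmx1, mulmx0, mulNmx, addr0, add0r)
    addrK.
have EVU : block_mx 1%:M (- U) V 1%:M =
    block_mx 1%:M 0 V 1%:M *m block_mx 1%:M (- U) 0 (1%:M + V *m U).
  by rewrite mulmx_block !(mul1mx, mul0mx, mulmx1, mulmx0, mulmxN, addr0, add0r)
    addrCA addNr addr0.
move: (congr1 determinant EUV); rewrite EVU !det_mulmx.
by rewrite !det_ublock !det_lblock !det1 !mul1r mulr1.
Qed.

Lemma scalemx_exp (R : comNzRingType) n (c : R) (A : 'M_n) k :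
  (c *: A) ^+ k = c ^+ k *: A ^+ k.
Proof.
elim: k => [|k IHk]; first by rewrite scale1r.
by rewrite !exprS IHk -[LHS]scalemxAl -scalemxAr scalerA.
Qed.

Lemma map_mxX (aR rR : pzRingType) (f : {rmorphism aR -> rR}) n (A : 'M_n) k :
  map_mx f (A ^+ k) = map_mx f A ^+ k.
Proof.
elim: k => [|k IHk]; first exact: map_mx1.
by rewrite !exprS -IHk; apply: map_mxM.
Qed.

(** The inverse of [1 + q N] is a finite geometric sum, with polynomial
    entries; so the determinant is a unit of [R[q]], hence constant, and its
    value at [q = 0] is 1. *)
Lemma det_1DX_nilpotent (R : idomainType) n (N : 'M[R]_n) k :
  N ^+ k = 0 -> \det (1%:M + 'X *: map_mx polyC N) = 1 :> {poly R}.
Proof.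
move=> Nk; set A := 'X *: _; pose G := \sum_(i < k) (- A) ^+ i.
have AG : (1%:M + A) *m G = 1%:M.
  have /eqP := subrX1 (- A) k.
  have -> : (- A) ^+ k = 0.
    have NPk : map_mx polyC N ^+ k = 0.
      by rewrite -map_mxX Nk map_mx0.
    rewrite /A -scaleNr scalemx_exp.
    exact: etrans (congr1 (fun M => _ *: M) NPk) (scaler0 _ _).
  rewrite sub0r -opprD mulNr eqr_opp eq_sym => /eqP.
  by rewrite addrC.
set p := \det _.
have pU : p \is a GRing.unit.
  have := congr1 determinant AG; rewrite det_mulmx det1 -/p => pG.
  by apply/unitrP; exists (\det G); rewrite mulrC pG.
move: pU; rewrite poly_unitE => /andP[/eqP p1 _].
rewrite [p]size1_polyC ?p1 // -horner_coef0 -/(horner_eval 0 p).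
rewrite /p -det_map_mx (_ : map_mx _ _ = 1%:M) ?det1 //.
apply/matrixP => i j; rewrite !mxE /= /horner_eval !hornerE.
by case: eqP; rewrite hornerC.
Qed.

(** The cyclic matrix differs from the nilpotent shift [N] by the single entry
    in the lower left corner. Since [(1 + c N) x] is the last basis vector for
    [x_i = (-c)^(m - i)], the matrix is the product of the unitriangular
    [1 + c N] and of the rank one perturbation [1 + c x e_0]. *)
Lemma det_1D_cyclic (R : comNzRingType) (c : R) k : (0 < k)%N ->
  \det (1%:M + c *: \matrix_(i < k, j < k) (j == ordS i)%:R) = 1 - (- c) ^+ k.
Proof.
case: k => // m _; set P := \matrix_(i, j) _.
pose N : 'M[R]_m.+1 := \matrix_(i, j) (j == i.+1 :> nat)%:R.
pose x : 'cV[R]_m.+1 := \col_i (- c) ^+ (m - i).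
(* The row vector that selects column 0, where the corner entry lies. *)
pose e : 'rV[R]_m.+1 := delta_mx 0 0.
have -> : 1%:M + c *: P = (1%:M + c *: N) *m (1%:M + c *: (x *m e)).
  have Nx : (1%:M + c *: N) *m x = delta_mx ord_max 0.
    rewrite mulmxDl mul1mx -scalemxAl; apply/matrixP => i j.
    rewrite !mxE ord1 eqxx andbT.
    have [im|im] := ltnP i m.
      rewrite (bigD1 (Ordinal (im : (i.+1 < m.+1)%N))) //= !mxE eqxx mul1r.
      rewrite big1 => [|l li]; last first.
        rewrite !mxE; case: eqP => [E|_]; last by rewrite mul0r.
        by case/eqP: li; apply/val_inj.
      rewrite -(subnSK im) exprS mulNr addr0 addNr.
      by case: eqP im => // ->; rewrite ltnn.
    rewrite big1 => [|l _]; last first.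
      rewrite !mxE; case: eqP => [E|_]; last by rewrite mul0r.
      by have := ltn_ord l; rewrite E ltnS ltnNge im.
    have -> : i = ord_max.
      by apply/val_inj/eqP; rewrite eqn_leq im -ltnS ltn_ord.
    by rewrite subnn mulr0 addr0 eqxx.
  rewrite mulmxDr mulmx1 -scalemxAr mulmxA Nx mul_delta_mx -addrA.
  congr (_ + _); rewrite -scalerDr; congr (_ *: _).
  apply/matrixP => i j; rewrite !mxE -natrD.
  congr (_%:R); rewrite -!(inj_eq val_inj) /=.
  have [im|im] := ltnP i m.
    by rewrite modn_small // (ltn_eqF im) addn0.
  have -> : i = m :> nat by apply/eqP; rewrite eqn_leq im -ltnS ltn_ord.
  by rewrite modnn eqxx (ltn_eqF (ltn_ord j)).
rewrite det_mulmx.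
have -> : \det (1%:M + c *: N) = 1.
  rewrite -det_tr det_trig ?big1 //.
    by move=> i _; rewrite !mxE eqxx (ltn_eqF (ltnSn _)) mulr0 addr0.
  apply/is_trig_mxP => i j ij; rewrite !mxE -!(inj_eq val_inj) /= (gtn_eqF ij).
  by rewrite (ltn_eqF (ltn_trans ij (ltnSn _))) mulr0 addr0.
rewrite mul1r scalemxAl det_1D_mulmxC det_mx11 !mxE eqxx.
rewrite (bigD1 ord0) //= big1 => [|l l0]; last by rewrite !mxE (negPf l0) mul0r.
by rewrite !mxE !eqxx mul1r addr0 subn0 exprS mulNr opprK.
Qed.

(** The orthogonality kills all mixed terms of the expanded product. *)
Lemma prod_1D (R : pzRingType) (I : eqType) (A : I -> R) (s : seq I) :
  uniq s -> {in s &, forall i j, i != j -> A i * A j = 0} ->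
  \prod_(i <- s) (1 + A i) = 1 + \sum_(i <- s) A i.
Proof.
elim: s => [|i s IHs] /=; first by rewrite !big_nil addr0.
move=> /andP[is_ us] A0; rewrite !big_cons IHs //; last first.
  by move=> j l js ls; apply: A0; rewrite inE ?js ?ls orbT.
suff AS : A i * \sum_(j <- s) A j = 0.
  by rewrite mulrDl mul1r mulrDr mulr1 AS addr0 -addrA (addrC (A i)).
rewrite mulr_sumr big1_seq // => j /andP[_ js].
apply: A0; rewrite ?inE ?eqxx ?js ?orbT //.
by apply: contraNneq is_ => ->.
Qed.

(** * Matrices of relations and walks *)

(** Matrices indexed by finite types, through the enumerations of these types,
    so that products of such matrices are sums over the types themselves. *)
Definition fun_mx (R : Type) (T1 T2 : finType) (f : T1 -> T2 -> R) :
    'M[R]_(#|T1|, #|T2|) :=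
  \matrix_(i, j) f (enum_val i) (enum_val j).

Definition rel_mx (R : pzSemiRingType) (T : finType) (r : rel T) : 'M[R]_#|T| :=
  fun_mx (fun x y => (r x y)%:R).

Lemma eq_fun_mx (R : Type) (T1 T2 : finType) (f g : T1 -> T2 -> R) :
  f =2 g -> fun_mx f = fun_mx g.
Proof. by move=> fg; apply/matrixP => i j; rewrite !mxE fg. Qed.

Lemma fun_mxM (R : pzSemiRingType) (T1 T2 T3 : finType)
    (f : T1 -> T2 -> R) (g : T2 -> T3 -> R) :
  fun_mx f *m fun_mx g = fun_mx (fun x z => \sum_y f x y * g y z).
Proof.
apply/matrixP => i j; rewrite !mxE.
rewrite [RHS](reindex (@enum_val T2 T2)); last exact/onW_bij/enum_val_bij.
by apply: eq_bigr => l _; rewrite !mxE.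
Qed.

Section Walks.
Variables (T : finType) (r : rel T).

Definition walks (k : nat) (x y : T) : nat :=
  #|[set s : k.-tuple T | path r x s && (last x s == y)]|.

Lemma sum_cons_tuple (R : nmodType) k (F : k.+1.-tuple T -> R) :
  \sum_t F t = \sum_x \sum_s F (cons_tuple x s).
Proof.
pose cons (u : T * k.-tuple T) := cons_tuple u.1 u.2.
rewrite pair_bigA /= (reindex cons) //.
exists (fun t => (thead t, behead_tuple t)) => [[x s]|t] _ /=.
  by congr (_, _); apply/val_inj.
by apply/val_inj; rewrite /= [in RHS](tuple_eta t).
Qed.

Lemma walksE k x y :
  walks k x y = (\sum_(s : k.-tuple T) (path r x s && (last x s == y)))%N.
Proof. by rewrite /walks cardsE -sum1_card big_mkcond. Qed.

Lemma walks0 x y : walks 0 x y = (x == y).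
Proof.
rewrite walksE (bigD1 [tuple]) //= big1 ?addn0 // => t.
by case/eqP; rewrite tuple0.
Qed.

Lemma walksS k x y : walks k.+1 x y = (\sum_z r x z * walks k z y)%N.
Proof.
rewrite walksE sum_cons_tuple; apply: eq_bigr => z _.
rewrite walksE big_distrr; apply: eq_bigr => s _ /=.
by rewrite -andbA; case: (r x z); rewrite ?mul1n ?mul0n.
Qed.

Lemma rel_mxX (R : pzSemiRingType) k :
  rel_mx R r ^+ k = fun_mx (fun x y => (walks k x y)%:R).
Proof.
elim: k => [|k IHk].
  by apply/matrixP => i j; rewrite !mxE walks0 (inj_eq enum_val_inj).
rewrite exprS IHk [LHS]fun_mxM; apply: eq_fun_mx => x y.
by rewrite walksS natr_sum; apply: eq_bigr => z _; rewrite natrM.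
Qed.

(** Powers of the matrix of a relation count paths. *)
Lemma rel_mx_nilpotent (R : pzSemiRingType) k :
  (forall x s, path r x s -> (size s < k)%N) -> rel_mx R r ^+ k = 0.
Proof.
move=> short; rewrite rel_mxX; apply/matrixP => i j; rewrite !mxE.
rewrite /walks eq_card0 // => s; rewrite !inE; apply/negP => /andP[/short].
by rewrite size_tuple ltnn.
Qed.

End Walks.

(** * Cycles of functional relations *)

Section Rotations.
Variables (T : finType) (k : nat).
Implicit Types p q : k.+1.-tuple T.

Definition rots p : {set k.+1.-tuple T} := [set rot_tuple i p | i : 'I_k.+1].

Lemma mem_rots p q : reflect (exists i, tval q = rot i p) (q \in rots p).
Proof.
apply: (iffP imsetP) => [[i _ ->]|[i qE]]; first by exists i.
have [ik|ki] := ltnP i k.+1; first by exists (Ordinal ik) => //; apply/val_inj.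
exists ord0 => //; apply/val_inj.
by rewrite /= qE rot_oversize ?size_tuple // rot0.
Qed.

Lemma rots_refl p : p \in rots p.
Proof. by apply/mem_rots; exists 0%N; rewrite rot0. Qed.

(** Rotation classes are equivalence classes. *)
Lemma rots_eq p q : q \in rots p -> rots q = rots p.
Proof.
have sub p1 q1 : q1 \in rots p1 -> rots q1 \subset rots p1.
  case/imsetP=> j _ ->; apply/fintype.subsetP => t /imsetP[i _ ->].
  apply/mem_rots; rewrite /= rot_add_mod; first by eexists.
    by rewrite size_tuple ltnW.
  by rewrite size_tuple ltnW.
move=> qp; apply/eqP; rewrite finset.eqEsubset !sub //.
case/mem_rots: qp => i qE; apply/mem_rots; exists (size q - i)%N.
by rewrite -/(rotr i q) qE rotK.
Qed.

End Rotations.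

Section FunctionalRelation.
Variables (T : finType) (r : rel T).

Definition cyclic_pt (x : T) : bool := [exists y, r x y && connect r y x].

(** On a cycle of a functional relation this is the set of points of the
    cycle; see [reach_cycle]. *)
Definition reach (x : T) : {set T} := [set y | connect r x y].

Definition cycle_sets : {set {set T}} := [set reach x | x in cyclic_pt].

Lemma cyclic_ptP x :
  reflect (exists p, [/\ cycle r p, uniq p & x \in p]) (cyclic_pt x).
Proof.
apply: (iffP existsP) => [[y /andP[rxy /connectP[q]]]|[p [rp up xp]]].
  move=> rq xE; case/shortenP: rq xE => q' rq' uq' _ xE.
  (* A path from [y] back to [x] without repetition closes up to a simple
     cycle. *)
  exists (y :: q'); split=> //; last by rewrite xE mem_last.
  by rewrite /= rcons_path rq' -xE.
exists (next p x); rewrite next_cycle //=.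
by apply: (connect_cycle rp); rewrite ?mem_next.
Qed.

(** A repetition on a path would put a point on a cycle. *)
Lemma path_size_acyclic x s :
  (forall x, ~~ cyclic_pt x) -> path r x s -> (size s < #|T|)%N.
Proof.
move=> ncyc rs; suff /card_uniqP us : uniq (x :: s).
  by have := max_card (mem (x :: s)); rewrite us.
elim: s x rs => //= y s IHs x /andP[rxy rs].
apply/andP; split; last exact: IHs rs.
apply: contra (ncyc x) => xs.
by apply/existsP; exists y; rewrite rxy (path_connect rs).
Qed.

Hypothesis r_fun : forall x y z, r x y -> r x z -> y = z.

Lemma functional_path_inj x s t :
  path r x s -> path r x t -> size s = size t -> s = t.
Proof.
elim: s x t => [|y s IHs] x [|z t] //= /andP[rxy rs] /andP[rxz rt] [st].
by have yz := r_fun rxy rxz; rewrite -yz in rt *; rewrite (IHs y t).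
Qed.

(** A functional relation cannot leave a cycle. *)
Lemma reach_cycle p x :
  cycle r p -> uniq p -> x \in p -> reach x = [set y in p].
Proof.
move=> rp up xp; apply/setP => y; rewrite !inE; apply/idP/idP => [|yp].
  case/connectP=> s rs ->; elim: s x xp rs => //= z s IHs x xp /andP[rxz].
  by apply: IHs; rewrite (r_fun rxz (next_cycle rp xp)) mem_next.
exact: (connect_cycle rp).
Qed.

Lemma cycle_setsP (X : {set T}) :
  reflect (exists p, [/\ cycle r p, uniq p, p != [::] & X = [set y in p]])
          (X \in cycle_sets).
Proof.
apply: (iffP imsetP) => [[x /cyclic_ptP[p [rp up xp]] ->]|[p [rp up p0 ->]]].
  by exists p; rewrite (reach_cycle rp up xp); split=> //; case: (p) xp.
case: p p0 rp up => // x p _ rp up; exists x; last first.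
  by rewrite (reach_cycle rp) ?mem_head.
by apply/cyclic_ptP; exists (x :: p); rewrite mem_head.
Qed.

(** A cycle is determined by any of its points; in particular different cycles
    are disjoint. *)
Lemma mem_cycle_sets (X : {set T}) x : X \in cycle_sets -> x \in X ->
  cyclic_pt x /\ X = reach x.
Proof.
case/cycle_setsP=> p [rp up _ ->]; rewrite inE => xp.
by split; [apply/cyclic_ptP; exists p|rewrite (reach_cycle rp)].
Qed.

Lemma reach_step x y : cyclic_pt x -> r x y -> cyclic_pt y /\ reach y = reach x.
Proof.
move=> cx rxy; have Xr : reach x \in cycle_sets by apply/imsetP; exists x.
have [||cy ->//] := @mem_cycle_sets (reach x) y => //.
by rewrite inE connect1.
Qed.

Lemma cycle_rot_eq p q : cycle r p -> uniq p -> cycle r q -> uniq q ->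
  q != [::] -> p =i q -> exists i, q = rot i p.
Proof.
case: q => // x q rp up rq uq _ pq.
(* Rotated to the common starting point [x], both are paths from [x] of the
   same length. *)
have [|i p' pE] := @rot_to _ p x; first by rewrite pq mem_head.
exists i; rewrite pE; congr (_ :: _).
move: rq rp up; rewrite -[cycle r p](rot_cycle i) -(rot_uniq i) pE /=.
rewrite !rcons_path => /andP[rq _] /andP[rp' _] /andP[xp' up'].
apply: functional_path_inj rq rp' _.
have /perm_size : perm_eq (x :: q) (x :: p').
  apply: uniq_perm => // [|y]; first by rewrite /= xp'.
  by rewrite -pE mem_rot pq.
by case.
Qed.

(** Two cycles without repetition are rotations of each other exactly when
    they have the same underlying set, so that rotation classes may be
    replaced by these sets, which are pairwise disjoint. *)
Lemma card_cycle_sets k : (0 < k)%N ->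
  #|[set [set rot_tuple i p | i : 'I_k] | p : k.-tuple T
       & cycle r p && uniq p]| = #|[set X in cycle_sets | #|X| == k]|.
Proof.
case: k => // k _; set D := [set _ | _].
(* The map from rotation classes to sets of points is injective by
   [cycle_rot_eq]. *)
pose supp (P : {set k.+1.-tuple T}) := [set x | [exists p in P, x \in tval p]].
have suppE p : supp (rots p) = [set x in tval p].
  apply/setP => x; rewrite !inE; apply/existsP/idP => [[q]|xp].
    by case/andP=> /mem_rots[i ->]; rewrite mem_rot.
  by exists p; rewrite xp rots_refl.
rewrite -(card_in_imset (f := supp)) => [|P P']; last first.
  case/imsetP=> p; rewrite inE => /andP[rp up] ->.
  case/imsetP=> p'; rewrite inE => /andP[rp' up'] ->.
  rewrite -!/(rots _) !suppE => /setP pp'; apply/esym/rots_eq/mem_rots.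
  apply: cycle_rot_eq => // [|x]; last by have := pp' x; rewrite !inE.
  by rewrite -size_eq0 size_tuple.
congr #|pred_of_set _|; apply/setP => X; rewrite inE.
apply/imsetP/andP => [[_ /imsetP[p + ->] ->]|].
  rewrite inE => /andP[rp up]; rewrite -/(rots p) suppE; split.
    by apply/cycle_setsP; exists p; rewrite -size_eq0 size_tuple.
  by rewrite cardsE (card_uniqP up) size_tuple.
case=> /cycle_setsP[p [rp up _ ->]]; rewrite cardsE (card_uniqP up) => sp.
exists (rots (Tuple sp)); last by rewrite suppE.
by apply/imsetP; exists (Tuple sp); rewrite ?inE ?rp.
Qed.

End FunctionalRelation.

Lemma next_nth_uniq (T : eqType) (p : seq T) x0 i : uniq p -> (i < size p)%N ->
  next p (nth x0 p i) = nth x0 p (i.+1 %% size p).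
Proof.
move=> up ip; rewrite next_nth mem_nth // index_uniq //.
case: p up ip => //= y p _; rewrite ltnS leq_eqVlt => /predU1P[->|ip].
  by rewrite modnn nth_default.
by rewrite modn_small //=; apply: set_nth_default.
Qed.

Section DetFunctional.
Variables (R : idomainType) (T : finType) (r : rel T).
Hypothesis r_fun : forall x y z, r x y -> r x z -> y = z.

Let qmx (e : rel T) : 'M[{poly R}]_#|T| := 'X *: rel_mx _ e.

Lemma qmxM0 (e e' : rel T) : (forall x y z, e x y -> e' y z -> false) ->
  qmx e * qmx e' = 0.
Proof.
move=> ee'; rewrite /qmx -[LHS]scalemxAl -scalemxAr fun_mxM.
rewrite (_ : fun_mx _ = 0) ?scaler0 //; apply/matrixP => i j; rewrite !mxE.
rewrite big1 // => z _; case exz: (e _ z); last by rewrite mul0r.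
by case ezy: (e' z _); [have := ee' _ _ _ exz ezy|rewrite mulr0].
Qed.

(** Restricted to one cycle of length [k], the matrix factors through the
    [k]-dimensional space indexed by the positions on the cycle, and the product
    of the factors in the other order is the cyclic matrix. *)
Lemma det_cycle_set (X : {set T}) : X \in cycle_sets r ->
  \det (1%:M + qmx (fun x y => r x y && (x \in X))) = 1 - (- 'X) ^+ #|X|.
Proof.
case/(cycle_setsP r_fun)=> p [rp up p0 ->]; rewrite cardsE (card_uniqP up).
pose k := size p; have k0 : (0 < k)%N by rewrite lt0n size_eq0.
pose pt i := tnth (in_tuple p) i.
pose U : 'M[{poly R}]_(#|T|, k) := \matrix_(a, i) (enum_val a == pt i)%:R.
pose V : 'M[{poly R}]_(k, #|T|) :=
  \matrix_(i, a) (enum_val a == next p (pt i))%:R.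
have ptp i : pt i \in p by apply: mem_tnth.
have pt_inj : injective pt by move=> i j; apply/tuple_uniqP.
have -> : qmx (fun x y => r x y && (x \in [set x in p])) = 'X *: (U *m V).
  congr (_ *: _); apply/matrixP => i j; rewrite !mxE inE.
  set x := enum_val i; set y := enum_val j.
  have [xp|xp] := boolP (x \in p); last first.
    rewrite andbF big1 // => l _; rewrite !mxE -/x.
    by case: eqP xp => [->|]; rewrite ?ptp ?mul0r.
  have /tnthP[l xl] : x \in in_tuple p by [].
  rewrite -/(pt l) in xl.
  rewrite (bigD1 l) //= big1 => [|l' ll']; last first.
    by rewrite !mxE -/x xl (inj_eq pt_inj) eq_sym (negPf ll') mul0r.
  rewrite !mxE -/x -/y xl eqxx mul1r addr0 -xl andbT.
  congr (_%:R); congr nat_of_bool; apply/idP/eqP => [rxy|->].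
    by apply: r_fun rxy _; rewrite next_cycle.
  by rewrite next_cycle.
rewrite scalemxAl det_1D_mulmxC -scalemxAr -det_1D_cyclic //.
congr (\det (_ + _ *: _)); apply/matrixP => i j; rewrite !mxE.
rewrite (bigD1 (enum_rank (next p (pt i)))) //= big1 => [|a ai]; last first.
  rewrite !mxE; case: eqP => [E|]; rewrite ?mul0r //.
  by case/eqP: ai; rewrite -E enum_valK.
rewrite !mxE enum_rankK eqxx mul1r addr0; congr (_%:R).
rewrite -(inj_eq pt_inj) eq_sym; congr (nat_of_bool (_ == _)).
by rewrite /pt !(tnth_nth (pt i)) next_nth_uniq.
Qed.

(** Removing the steps that start on a cycle leaves an acyclic relation, so
    its matrix is nilpotent. *)
Lemma det_acyclic_rest :
  \det (1%:M + qmx (fun x y => r x y && ~~ cyclic_pt r x)) = 1.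
Proof.
set e := fun x y => _.
have e0 : rel_mx R e ^+ #|T| = 0.
  apply: rel_mx_nilpotent => x s; apply: path_size_acyclic => {x s} x.
  apply/existsP => -[y /andP[/andP[rxy /negP ncx] yx]]; case: ncx.
  apply/existsP; exists y; rewrite rxy.
  by apply: connect_sub yx => a b /andP[rab _]; exact: connect1.
rewrite -[RHS](det_1DX_nilpotent e0); congr (\det (_ + _ *: _)).
by apply/matrixP => i j; rewrite !mxE polyC_natr.
Qed.

(** A step that starts on a cycle ends on the same cycle. So the restrictions
    of the matrix to the cycles annihilate each other, and each of them
    annihilates, from the left, the part that starts outside of the cycles: the
    sum [1 + q Z] becomes a product. *)
Lemma det_functional :
  \det (1%:M + 'X *: rel_mx {poly R} r) =
  \prod_(X in cycle_sets r) (1 - (- 'X) ^+ #|X|).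
Proof.
pose eX (X : {set T}) x y := r x y && (x \in X).
pose e0 x y := r x y && ~~ cyclic_pt r x.
have memE := mem_cycle_sets r_fun.
have stepE := reach_step r_fun.
have sumE : \sum_(X in cycle_sets r) qmx (eX X) =
    qmx (fun x y => r x y && cyclic_pt r x).
  rewrite -scaler_sumr; congr (_ *: _); apply/matrixP => i j.
  rewrite summxE !mxE; set x := enum_val i.
  case cx: (cyclic_pt r x); last first.
    rewrite andbF big1 // => X Xr; rewrite !mxE /eX -/x.
    case xX: (x \in X); rewrite ?andbF //.
    by have [] := memE _ _ Xr xX; rewrite cx.
  have Xr : reach r x \in cycle_sets r by apply/imsetP; exists x.
  rewrite (bigD1 _ Xr) /= big1 => [|X /andP[X' XX]]; last first.
    rewrite !mxE /eX -/x; case xX: (x \in X); rewrite ?andbF //.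
    by case/eqP: XX; rewrite (memE _ _ X' xX).2.
  by rewrite !mxE /eX -/x inE connect0 !andbT addr0.
have -> : 1%:M + 'X *: rel_mx _ r =
    \prod_(X <- enum (cycle_sets r)) (1%:M + qmx (eX X)) * (1%:M + qmx e0).
  rewrite prod_1D ?enum_uniq // => [|X Y]; last first.
    rewrite !mem_enum => Xr Yr XY; apply: qmxM0 => x y z.
    move=> /andP[rxy xX] /andP[_ yY]; case/eqP: XY.
    have [cx ->] := memE _ _ Xr xX; have [cy ->] := memE _ _ Yr yY.
    by rewrite (stepE _ _ cx rxy).2.
  rewrite big_enum sumE mulrDl mul1r mulrDr mulr1 qmxM0 ?addr0; last first.
    by move=> x y z /andP[rxy cx] /andP[_]; rewrite (stepE _ _ cx rxy).1.
  rewrite -addrA -scalerDr; congr (_ + _ *: _); apply/matrixP => i j.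
  rewrite !mxE -natrD /e0.
  by case: cyclic_pt; rewrite ?andbT ?andbF ?addn0 ?add0n.
rewrite [LHS]det_mulmx det_acyclic_rest mulr1.
rewrite (big_morph determinant (@det_mulmx _ _) (det1 _ _)) -big_enum /=.
by apply: eq_big_seq => X; rewrite mem_enum; exact: det_cycle_set.
Qed.

End DetFunctional.

(** * Counting nonzero paths in a quiver *)

Section PathCount.
Variables (Q : quiver) (nonrel z : rel (arrow Q)).
Hypothesis comp_split :
  forall a b : arrow Q, (tgt a == src b) = nonrel a b || z a b.
Hypothesis nzz : forall a b, nonrel a b -> ~~ z a b.

Definition nonzero_paths n (v w : vertex Q) : {set n.-tuple (arrow Q)} :=
  [set t : n.-tuple (arrow Q) |
    [&& is_qpath v t, last v (map tgt t) == w & sorted nonrel t]]%SET.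

Lemma card_nonzero_paths0 v w : #|nonzero_paths 0 v w| = (v == w).
Proof.
rewrite -sum1dep_card big_mkcond (bigD1 [tuple]) //= big1 ?addn0 => [|t].
  by rewrite andbT; case: eqP.
by case/eqP; rewrite tuple0.
Qed.

Lemma is_qpath_walk a s : path nonrel a s -> is_qpath (tgt a) s.
Proof.
elim: s a => //= b s IHs a /andP[ab bs]; rewrite IHs // andbT eq_sym.
by rewrite comp_split ab.
Qed.

(** A path of positive length is a walk on its arrows. *)
Lemma card_nonzero_pathsS n v w : #|nonzero_paths n.+1 v w| =
  (\sum_a \sum_b (src a == v) * (walks nonrel n a b * (tgt b == w)))%N.
Proof.
rewrite -sum1dep_card big_mkcond sum_cons_tuple; apply: eq_bigr => a _ /=.
under [RHS]eq_bigr => b _ do rewrite walksE big_distrl big_distrr /=.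
rewrite exchange_big; apply: eq_bigr => s _ /=.
rewrite (bigD1 (last a s)) //= big1 ?addn0 => [|b bs]; last first.
  by rewrite [_ == b]eq_sym (negPf bs) andbF mul0n muln0.
rewrite eqxx andbT (last_map tgt).
case: (src a == v) => //=; rewrite mul1n.
case as_: (path nonrel a s); rewrite ?andbF // (is_qpath_walk as_) andbT mul1n.
by case: (_ == w).
Qed.

(** The generating matrix is [1 + q S G E] with [G = (1 - q B)^-1]; exchanging
    the factors [q S] and [G E] replaces vertices by arrows. Since
    [E S = B + Z], where [Z] is the matrix of [z], multiplying by [1 - q B],
    whose determinant is 1, then leaves [1 - q B + q (B + Z)]. *)
Lemma det_nonzero_paths k :
  (forall a s, path nonrel a s -> (size s < k)%N) ->
  \det (fun_mx (fun v w => \sum_(n < k.+1) (#|nonzero_paths n v w|)%:R *: 'X^n)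
        : 'M[{poly int}]_#|vertex Q|) =
  \det (1%:M + 'X *: rel_mx {poly int} z).
Proof.
move=> short; pose B := rel_mx {poly int} nonrel.
pose G : 'M[{poly int}]_#|arrow Q| := \sum_(n < k) ('X *: B) ^+ n.
pose S : 'M[{poly int}]_(#|vertex Q|, #|arrow Q|) :=
  fun_mx (fun v a => (src a == v)%:R).
pose E : 'M[{poly int}]_(#|arrow Q|, #|vertex Q|) :=
  fun_mx (fun a v => (tgt a == v)%:R).
have detB : \det (1%:M - 'X *: B) = 1.
  have Bk : (- rel_mx int nonrel) ^+ k = 0.
    by rewrite exprNn (rel_mx_nilpotent _ short) mulr0.
  rewrite -[RHS](det_1DX_nilpotent Bk) -scalerN; congr (\det (_ + _ *: _)).
  by apply/matrixP => i j; rewrite !mxE polyCN polyC_natr.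
have BG : (1%:M - 'X *: B) *m G = 1%:M.
  have Bk : ('X *: B) ^+ k = 0.
    rewrite scalemx_exp.
    apply: etrans (scaler0 _ _); congr (_ *: _).
    exact: rel_mx_nilpotent short.
  by have := subrX1 ('X *: B) k; rewrite Bk sub0r -opprB mulNr => /oppr_inj.
have ES : E *m S = B + rel_mx _ z.
  rewrite fun_mxM; apply/matrixP => i j; rewrite !mxE.
  set a := enum_val i; set b := enum_val j.
  rewrite (bigD1 (tgt a)) //= big1 => [|v va]; last first.
    by rewrite eq_sym (negPf va) mul0r.
  rewrite eqxx mul1r addr0 eq_sym comp_split -natrD; congr (_%:R).
  by case ab: (nonrel a b) => //=; rewrite (negPf (nzz ab)).
set C := fun_mx _; have -> : C = 1%:M + ('X *: S) *m (G *m E).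
  have SBE n : S *m (B ^+ n *m E) =
      fun_mx (fun v w => (#|nonzero_paths n.+1 v w|)%:R).
    rewrite rel_mxX !fun_mxM; apply: eq_fun_mx => v w.
    rewrite card_nonzero_pathsS natr_sum; apply: eq_bigr => a _.
    rewrite natr_sum mulr_sumr; apply: eq_bigr => b _.
    by rewrite !natrM.
  rewrite mulmx_suml mulmx_sumr; apply/matrixP => i j.
  rewrite !mxE big_ord_recl card_nonzero_paths0 expr0 (inj_eq enum_val_inj).
  rewrite scaler_nat summxE; congr (_ + _).
  apply: eq_bigr => n _; rewrite scalemx_exp -!scalemxAl -scalemxAr scalerA.
  by rewrite SBE -exprS !mxE mulr_natr scaler_nat.
rewrite det_1D_mulmxC -[LHS]mul1r -[X in X * _]detB -det_mulmx; congr (\det _).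
rewrite mulmxDr mulmx1 -scalemxAr -mulmxA ES -scalemxAr mulmxA BG mul1mx.
by rewrite scalerDr addrA subrK.
Qed.

End PathCount.

(** * Dimensions in a quadratic monomial algebra *)

Section DimensionTheory.
Variables (K : fieldType) (V : lmodType K).

(** A nonzero vector in the left kernel of the matrix of coordinates would be a
    linear relation. *)
Lemma lin_indep_size n m (b : 'I_n -> V) (e : 'I_m -> V) :
  (forall c : 'I_n -> K, \sum_i c i *: b i = 0 -> forall i, c i = 0) ->
  (forall i, exists c : 'I_m -> K, b i = \sum_j c j *: e j) -> (n <= m)%N.
Proof.
move=> bfree /fin_all_exists[c bE].
pose A : 'M[K]_(n, m) := \matrix_(i, j) c i j.
suff /eqP <- : row_free A by exact: rank_leq_col.
apply: inj_row_free => u uA; apply/rowP => i; rewrite mxE.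
apply: (bfree (fun i => u 0 i)).
under eq_bigr => l _ do rewrite bE scaler_sumr.
rewrite exchange_big big1 //= => j _.
under eq_bigr => l _ do rewrite scalerA.
rewrite -scaler_suml; move/rowP/(_ j): uA; rewrite !mxE => uA.
rewrite (_ : \sum_(i < n) _ = 0) ?scale0r // -[RHS]uA.
by apply: eq_bigr => l _; rewrite !mxE.
Qed.

Lemma dimK_basis (W : set V) n (b : 'I_n -> V) : is_basis W b -> dimK W = n.
Proof.
move=> bB; rewrite /dimK; apply: xget_unique; first by exists b.
move=> m [e eB]; case: bB eB => Wb fb sb [We fe se].
apply/eqP; rewrite eqn_leq (lin_indep_size fe (fun i => sb _ (We i))).
exact: lin_indep_size fb (fun i => se _ (Wb i)).
Qed.

End DimensionTheory.

Section MonomialIdeal.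
Variables (K : fieldType) (Q : quiver) (I : ideal2 (pathalg K Q)).

Definition nonrel (a b : arrow Q) : bool := ~~ zero_rel I a b.
Definition nonrel_path (p : qpath Q) : bool := sorted nonrel (parrows p).

Lemma pathelt_cons (p q : qpath Q) a : parrows p = a :: parrows q ->
  pstart q = tgt a -> pathelt K p = arrowelt K a * pathelt K q.
Proof.
move=> pE qa; rewrite patheltM.
have [r -> [rs ra _]] := @pconcatE _ (arrow_path a) q (esym qa).
congr (pathelt K _); apply: qpath_inj; last by rewrite ra pE.
by rewrite rs; have := qpathP p; rewrite pE /= => /andP[/eqP <-].
Qed.

Lemma pathelt2 (p : qpath Q) a b : parrows p = [:: a; b] ->
  pathelt K p = arrowelt K a * arrowelt K b.
Proof.
move=> pE; apply: pathelt_cons => //.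
by have := qpathP p; rewrite pE /= => /and3P[_ /eqP].
Qed.

Lemma nonrel_composable a b : nonrel a b -> tgt a = src b.
Proof.
apply: contraNeq => ab; rewrite /zero_rel /arrowelt patheltM pconcatN //.
exact: rpred0.
Qed.

(** Such a path factors as [u a b v] with [a b] a zero relation. *)
Lemma pathelt_in_ideal (p : qpath Q) : ~~ nonrel_path p -> pathelt K p \in I.
Proof.
move sE: (parrows p) => s; rewrite /nonrel_path sE.
elim: s p sE => // a [|b s] IHs p sE //=; rewrite negb_and.
have := qpathP p; rewrite sE /= => /and3P[_ /eqP ba qs].
have qP : is_qpath (tgt a, b :: s).1 (tgt a, b :: s).2.
  by rewrite /= ba eqxx.
pose q := QPath qP; rewrite (@pathelt_cons p q a) //.
case/orP=> [/negPn ab|]; last first.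
  by move=> bs; apply/ideal2Ml/IHs.
pose r := @QPath Q (tgt b, s) qs.
by rewrite (@pathelt_cons q r b) // mulrA; apply: ideal2Mr.
Qed.

(** The span of the paths that contain a zero relation. *)
Definition nonrel_free : {pred pathalg K Q} :=
  fun x => all (fun p => ~~ nonrel_path p) (enum_fset (msupp x)).

Lemma nonrel_freeP (x : pathalg K Q) :
  reflect (forall p, nonrel_path p -> x@_p = 0) (x \in nonrel_free).
Proof.
apply: (iffP allP) => [H p|H p].
  by apply: contraTeq; rewrite mcoeff_neq0 => /H.
by rewrite -mcoeff_neq0; apply: contraNN => /H ->.
Qed.

Lemma nonrel_free_zmod : zmod_closed nonrel_free.
Proof.
split=> [|x y /nonrel_freeP x0 /nonrel_freeP y0]; apply/nonrel_freeP => p pnz.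
  exact: mcoeff0.
by rewrite mcoeffB x0 // y0 // subr0.
Qed.

HB.instance Definition _ :=
  GRing.isZmodClosed.Build (pathalg K Q) nonrel_free nonrel_free_zmod.

Lemma nonrel_free_pterm c (p q : qpath Q) :
  ~~ nonrel_path p || ~~ nonrel_path q -> pterm c p q \in nonrel_free.
Proof.
have [pq|pq] := eqVneq (pend p) (pstart q); last first.
  by rewrite /pterm pconcatN // rpred0.
have [r rE [_ ra _]] := pconcatE pq; rewrite /pterm rE -negb_and => npq.
apply/nonrel_freeP => t tnz; rewrite mcoeffU.
case: eqP => // tr; case/negP: npq.
move: tnz; rewrite /nonrel_path -tr ra => /cat_sorted2[-> ->] //.
Qed.

Lemma nonrel_free_mul : mul_closed_ideal nonrel_free.
Proof.
move=> y x /allP xI; rewrite !pathalgM unlock; split.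
  apply: rpred_sum => p _; rewrite big_seq; apply: rpred_sum => q /xI qI.
  by rewrite nonrel_free_pterm // qI orbT.
rewrite big_seq; apply: rpred_sum => p /xI pI; apply: rpred_sum => q _.
by rewrite nonrel_free_pterm // pI.
Qed.

HB.instance Definition _ :=
  isMulClosedIdeal.Build (pathalg K Q) nonrel_free nonrel_free_mul.

Hypothesis genI : exists S : set (qpath Q),
    (forall p, S p -> plength p = 2%N) /\
    (forall x, x \in I <-> generated_ideal (@pathelt K Q @` S)%classic x).

(** The combinations of paths that contain a zero relation form an ideal, as a
    path is zero as soon as one of its parts is; it contains the generators of
    [I], which are zero relations themselves, hence also [I]. *)
Lemma mem_idealP (x : pathalg K Q) :
  x \in I <-> forall p, nonrel_path p -> x@_p = 0.
Proof.
split=> [xI|x0].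
  apply/nonrel_freeP; case: genI xI => S [S2 IS] /IS; apply=> _ [s Ss <-].
  have sI : pathelt K s \in I by apply/IS => J; apply; exists s.
  have := S2 s Ss; rewrite /plength.
  case sE: (parrows s) => [|a [|b []]] // _.
  apply/nonrel_freeP => p pnz; rewrite /pathelt mcoeffU; case: eqP => // sp.
  move: pnz; rewrite -sp /nonrel_path sE /= andbT.
  by rewrite /nonrel /zero_rel -(pathelt2 sE) sI.
rewrite [x]monalgE big_seq; apply: rpred_sum => p px.
have : ~~ nonrel_path p.
  by apply: contraTN px => /x0 xp; rewrite -mcoeff_neq0 xp eqxx.
move=> /pathelt_in_ideal pI; rewrite (_ : << _ *g p >> = x@_p *: pathelt K p).
  by rewrite pathalg_scale1 ideal2Ml.
by rewrite /pathelt pathalgUZ mulr1.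
Qed.

End MonomialIdeal.

Section CartanEntries.
Variables (K : fieldType) (Q : quiver) (I : ideal2 (pathalg K Q)).
Hypothesis memI : forall x : pathalg K Q,
  x \in I <-> forall p, nonrel_path I p -> x@_p = 0.

Lemma qapiP x y : reflect (qapi I x = qapi I y) (x - y \in I).
Proof. exact: quotpiP. Qed.

Lemma qapiM x y : qapi I (x * y) = qapi I x * qapi I y.
Proof. exact: quotpiM. Qed.

Lemma qapi0 : qapi I 0 = 0.
Proof. by apply: (addrI (qapi I 0)); rewrite -qapiD !addr0. Qed.

Lemma qapi_sum n (c : 'I_n -> K) (f : 'I_n -> pathalg K Q) :
  \sum_i c i *: qapi I (f i) = qapi I (\sum_i c i *: f i).
Proof.
rewrite (big_morph (qapi I) (@qapiD _ _ I) qapi0).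
by apply: eq_bigr => i _; rewrite qapiZ.
Qed.

Lemma coef_sum_path n (c : 'I_n -> K) (f : 'I_n -> qpath Q) p :
  (\sum_i c i *: pathelt K (f i))@_p = \sum_i c i *+ (f i == p).
Proof.
rewrite raddf_sum; apply: eq_bigr => i _.
by rewrite /pathelt pathalgUZ mulr1 /= mcoeffU.
Qed.

Lemma nonrel_paths_free n (f : 'I_n -> qpath Q) (c : 'I_n -> K) :
  injective f -> (forall i, nonrel_path I (f i)) ->
  \sum_i c i *: qapi I (pathelt K (f i)) = 0 -> forall i, c i = 0.
Proof.
move=> finj fnz; rewrite qapi_sum -qapi0 => /qapiP.
rewrite subr0 => /memI c0 i; have := c0 _ (fnz i).
rewrite coef_sum_path (bigD1 i) //= eqxx big1 ?addr0 // => j ji.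
by rewrite (inj_eq finj) (negPf ji).
Qed.

(** The initial parts of a nonzero path are linearly independent in the
    algebra, having different lengths; so the length is bounded by the
    dimension. *)
Lemma nonrel_walk_size d (e : 'I_d -> quiver_alg I) :
  is_basis [set: quiver_alg I]%classic e ->
  forall a s, path (nonrel I) a s -> (size s < d)%N.
Proof.
move=> [_ _ se] a s nzs.
have qP (i : 'I_(size s).+1) :
    is_qpath (src a, a :: take i s).1 (src a, a :: take i s).2.
  rewrite /= eqxx; move: (nat_of_ord i) => k {i}.
  elim: s a k nzs => //= b s IHs a [|j] //=.
  by case/andP=> /nonrel_composable -> nzs; rewrite eqxx IHs.
pose f i := QPath (qP i).
pose g i := qapi I (pathelt K (f i)).
apply: (@lin_indep_size K (quiver_alg I) _ _ g e).
  move=> c; apply: nonrel_paths_free => [i j|i].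
    move=> /(congr1 (size \o @parrows Q)) /=.
    have le_ord (k : 'I_(size s).+1) : (k <= size s)%N by rewrite -ltnS.
    by rewrite !size_takel // => -[ij]; apply/val_inj.
  exact: take_path.
by move=> i; apply: se.
Qed.

Lemma coef_peirce v w (x : pathalg K Q) (p : qpath Q) :
  (pidem K v * x * pidem K w)@_p = x@_p *+ ((pstart p == v) && (pend p == w)).
Proof.
rewrite !pathalgM; elim/pathalg_ind: x => [|x y IHx IHy|c q].
- by rewrite pamul0r pamul0l mcoeff0 mul0rn.
- by rewrite pamulDr pamulDl !mcoeffD IHx IHy mulrnDl.
rewrite pamulUU /pterm pconcat_trivl mul1r.
have [->|vq] := eqVneq; last first.
  rewrite pamul0l mcoeff0 mcoeffU; case: eqP => [<-|]; last by rewrite mul0rn.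
  by rewrite eq_sym (negPf vq).
rewrite pamulUU /pterm pconcat_trivr mulr1.
have [<-|wq] := eqVneq.
  by rewrite !mcoeffU; case: eqP => [->|]; rewrite ?eqxx // mul0rn.
rewrite mcoeff0 mcoeffU; case: eqP => [<-|]; last by rewrite mul0rn.
by rewrite (negPf wq) andbF.
Qed.

(** The classes of the nonzero paths form a basis: the coordinates of
    [e_v x e_w] are the coefficients of [x] at these paths, because the
    difference has no nonzero path in its support. *)
Lemma dimK_peirce v w n :
  dimK (@peirce_deg K Q I v w n) = #|nonzero_paths (nonrel I) n v w|.
Proof.
(* The default value [trivial_path v] is never taken, by [fE]. *)
pose f (i : 'I_#|nonzero_paths (nonrel I) n v w|) : qpath Q :=
  insubd (trivial_path v) (v, tval (enum_val i)).
have fE i : qpath_val (f i) = (v, tval (enum_val i)).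
  rewrite insubdK //.
  by have := enum_valP i; rewrite inE unfold_in /= => /and3P[].
have fs i : pstart (f i) = v by rewrite /pstart fE.
have fe i : pend (f i) = w.
  rewrite /pend fs /parrows fE.
  by have := enum_valP i; rewrite inE => /and3P[_ /eqP].
have fnz i : nonrel_path I (f i).
  rewrite /nonrel_path /parrows fE.
  by have := enum_valP i; rewrite inE => /and3P[].
have finj : injective f.
  move=> i j /(congr1 (@qpath_val Q)); rewrite !fE => -[] /val_inj.
  exact: enum_val_inj.
have fsurj p : nonrel_path I p -> pstart p = v -> pend p = w -> plength p = n ->
    exists i, f i = p.
  move=> pnz ps pe /eqP pn.
  have tP : Tuple pn \in nonzero_paths (nonrel I) n v w.
    by rewrite inE /= -ps qpathP [last _ _]pe eqxx.
  exists (enum_rank_in tP (Tuple pn)); apply: qpath_inj; first by rewrite fs.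
  by rewrite /parrows fE enum_rankK_in.
pose g i := qapi I (pathelt K (f i)).
apply: (@dimK_basis K (quiver_alg I) _ _ g); split.
- move=> i; exists (qapi I (pathelt K (f i))).
    exists (pathelt K (f i)) => //= p /(fsubsetP msuppU_le).
    rewrite inE => /eqP->.
    by rewrite /plength /parrows fE size_tuple.
  rewrite /qidem -!qapiM; apply/qapiP; apply/memI => p _.
  rewrite mcoeffB coef_peirce mcoeffU.
  case: eqP => [<-|]; last by rewrite mul0rn subr0.
  by rewrite fs fe !eqxx subrr.
- by move=> c; apply: nonrel_paths_free.
move=> _ [_ [x xn <-] <-]; exists (fun i => x@_(f i)).
rewrite qapi_sum /qidem -!qapiM; apply/qapiP; apply/memI => p pnz.
rewrite mcoeffB coef_peirce coef_sum_path.
have [[i <-]|nf] := pselect (exists i, f i = p).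
  rewrite fs fe !eqxx (bigD1 i) //= eqxx big1 ?addr0 ?subrr // => j ji.
  by rewrite (inj_eq finj) (negPf ji).
rewrite big1 => [|i _]; last by case: eqP => // fp; case: nf; exists i.
rewrite subr0; have [ps|//] := eqVneq (pstart p) v.
have [pe|//] := eqVneq (pend p) w.
have [px|/mcoeff_outdom //] := boolP (p \in msupp x).
by case: nf; apply: fsurj => //; apply: xn.
Qed.

(** The bound is on walks of arrows, whose size does not count the first arrow;
    hence nonzero paths have length at most [d]. *)
Lemma cartan_entryE d v w :
  (forall a s, path (nonrel I) a s -> (size s < d)%N) ->
  cartan_entry I v w =
  \sum_(n < d.+1) (#|nonzero_paths (nonrel I) n v w|)%:R *: 'X^n.
Proof.
move=> short; rewrite /cartan_entry (fsbigE (iota 0 d.+1)) ?iota_uniq //.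
- rewrite -[iota _ _]/(index_iota 0 d.+1) big_mkcond big_mkord.
  apply: eq_bigr => n _; rewrite dimK_peirce natz.
  by rewrite mem_setT.
move=> n _; rewrite mem_iota add0n -leqNgt => dn.
rewrite dimK_peirce; set S := nonzero_paths _ _ _ _.
suff /eq_card0 -> : S =i pred0 by rewrite scale0r.
move=> [[|a s] sn]; rewrite !inE; first by rewrite -(eqP sn) in dn.
apply/negP => /and3P[_ _ /short]; rewrite ltnNge.
by rewrite -ltnS [(size s).+1](eqP sn) dn.
Qed.

End CartanEntries.

(** * The determinant of the Cartan matrix *)

(** The finite-support product over all lengths is the product over the cycles,
    grouped by their size, which is between 1 and [#|T|]. *)
Lemma fsbig_cycle_sets (T : finType) (r : rel T) (R : comPzRingType)
    (F : nat -> R) (c : nat -> nat) :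
  (forall k, (0 < k)%N -> c k = #|[set X in cycle_sets r | #|X| == k]%SET|) ->
  \big[*%R/1]_(k \in [set k : nat | (0 < k)%N]%classic) F k ^+ c k =
  \prod_(X in cycle_sets r) F #|X|.
Proof.
move=> cE.
have X0 X : X \in cycle_sets r -> (0 < #|X|)%N.
  by case/imsetP=> x _ ->; apply/card_gt0P; exists x; rewrite inE connect0.
rewrite (fsbigE (iota 1 #|T|)) ?iota_uniq //.
- pose card_ord (X : {set T}) : 'I_#|T|.+1 := inord #|X|.
  rewrite (partition_big card_ord predT) //=.
  (* The index 0 of the partition is void, as cycles are nonempty. *)
  rewrite big_ord_recl [X in _ = X * _]big1 ?mul1r; last first.
    move=> X /andP[Xc /eqP/(congr1 val)].
    by rewrite /= inordK ?ltnS ?max_card // => E; have := X0 X Xc; rewrite E.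
  rewrite -[iota 1 #|T|]/(iota (1 + 0) #|T|) iotaDl big_map.
  have -> : iota 0 #|T| = index_iota 0 #|T| by rewrite /index_iota subn0.
  rewrite big_mkcond big_mkord.
  apply: eq_bigr => k _; rewrite mem_set //= cE //.
  rewrite -prodr_const; apply: eq_big => [X|X].
    rewrite inE; congr (_ && _); rewrite -(inj_eq val_inj) /= inordK //.
    by rewrite ltnS max_card.
  by rewrite inE => /andP[_ /eqP ->].
- by move=> k /=; rewrite mem_iota => /andP[].
move=> k k0; rewrite mem_iota k0 add1n ltnS /= -ltnNge => Tk.
rewrite cE // eq_card0 // => X; rewrite !inE; apply/negP => /andP[_ /eqP Xk].
by have := max_card (mem X); rewrite Xk leqNgt Tk.
Qed.

Local Open Scope classical_set_scope.

Theorem corollary1 (K : fieldType) (Q : quiver) (I : ideal2 (pathalg K Q))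
    (gentleI : gentle I) (findimA : finite_dim [set: quiver_alg I]) :
  \det (cartan_matrix I) =
    \big[*%R/1]_(k \in [set k : nat | (0 < k)%N])
      (1 - (- 'X : {poly int}) ^+ k) ^+ num_minimal_cycles I k.
Proof.
have memI := mem_idealP (gentle_generated gentleI).
have [d [e eB]] := findimA.
have short := nonrel_walk_size memI eB.
pose z (a b : arrow Q) := (tgt a == src b) && zero_rel I a b.
have z_fun a b c : z a b -> z a c -> b = c.
  move=> /andP[/eqP ab zab] /andP[/eqP ac zac].
  exact: (gentle_rel_right gentleI ab zab ac zac).
have comp_split a b : (tgt a == src b) = nonrel I a b || z a b.
  rewrite /z; case: eqP => [_|ab]; first by rewrite orNb.
  by rewrite orbF; apply/esym; apply: contra_notF ab => /nonrel_composable.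
have nzz a b : nonrel I a b -> ~~ z a b.
  by rewrite /nonrel /z => /negPf ->; rewrite andbF.
rewrite (fsbig_cycle_sets (r := z)) => [|k k0]; last first.
  exact: card_cycle_sets z_fun k k0.
rewrite -(det_functional _ z_fun) -(det_nonzero_paths comp_split nzz short).
congr (\det _); apply/matrixP => i j; rewrite !mxE.
exact: cartan_entryE.
Qed.
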